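(* Let $q_1,q_2$ be distinct primes with $q_1\equiv q_2\equiv 3\pmod 4$ and let $K=\mathbb{Q}(\sqrt{q_1},\sqrt{q_2})$. Let $\epsilon_1,\epsilon_2,\epsilon_3$ be the fundamental units of $\mathbb{Q}(\sqrt{q_1})$, $\mathbb{Q}(\sqrt{q_2})$, $\mathbb{Q}(\sqrt{q_1q_2})$, respectively. Then $\sqrt{\epsilon_1\epsilon_2}$ and $\sqrt{\epsilon_3}$ lie in $K$ and $\{\sqrt{\epsilon_1\epsilon_2},\sqrt{\epsilon_3},\epsilon_2\}$ is a set of fundamental units for $K$. Furthermore: (1) if $q_1\equiv q_2\equiv 3\pmod 8$, the unit signature rank of $K$ is $3$, i.e. $K$ has deficiency $1$; (2) if $q_1\equiv q_2\equiv 7\pmod 8$, the unit signature rank of $K$ is $2$, i.e. $K$ has deficiency $2$; (3) if $q_1\equiv 7\pmod 8$ and $q_2\equiv 3\pmod 8$, then the unit signature rank of $K$ is $3$ and the deficiency is $1$ if the Legendre symbol $(q_1/q_2)=+1$, while the unit signature rank and the deficiency are both equal to $2$ if $(q_1/q_2)=-1$.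
   Context: For a totally real field $F$ of degree $n$ and $0\neq\alpha\in F$, the signature of $\alpha$ is the vector in $\mathbb{F}_2^n$ whose entry at a real embedding $v$ is $0$ if $v(\alpha)>0$ and $1$ if $v(\alpha)<0$. The signatures of the units of $F$ form a subspace of $\mathbb{F}_2^n$; its dimension is the unit signature rank of $F$, and the deficiency of $F$ is $n$ minus the unit signature rank. *)

(* Defs.v *)
From HB Require Import structures.
From mathcomp Require Import all_boot all_order all_algebra all_field.
From mathcomp Require Import boolp.
Set Implicit Arguments. Unset Strict Implicit. Unset Printing Implicit Defensive.
Import Order.TTheory GRing.Theory Num.Theory.
Local Open Scope ring_scope.

Definition inQsqrt (m : nat) (x : algC) : Prop :=
  exists a b : rat, x = ratr a + ratr b * sqrtC m%:R.

Definition inK (q1 q2 : nat) (x : algC) : Prop :=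
  exists a b c d : rat,
    x = ratr a + ratr b * sqrtC q1%:R + ratr c * sqrtC q2%:R
        + ratr d * (sqrtC q1%:R * sqrtC q2%:R).

Definition is_unit_of (F : algC -> Prop) (x : algC) : Prop :=
  F x /\ x != 0 /\ x \in Aint /\ x^-1 \in Aint.

Definition is_fund_unit_quad (m : nat) (e : algC) : Prop :=
  is_unit_of (inQsqrt m) e /\ 1 < e /\
  forall u, is_unit_of (inQsqrt m) u -> exists k : int, u = e ^ k \/ u = - e ^ k.

Definition fund_system3 (F : algC -> Prop) (x y z : algC) : Prop :=
  [/\ is_unit_of F x, is_unit_of F y, is_unit_of F z,
      (forall u, is_unit_of F u ->
         exists a b c : int, u = x ^ a * y ^ b * z ^ c \/ u = - (x ^ a * y ^ b * z ^ c))
    & (forall a b c : int, x ^ a * y ^ b * z ^ c = 1 \/ x ^ a * y ^ b * z ^ c = -1 ->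
         [/\ a = 0, b = 0 & c = 0])].

(* The four real embeddings of K, indexed by i : 'I_4:
   sigma_i(sqrt q1) = (-1)^(bit0 i) sqrt q1, sigma_i(sqrt q2) = (-1)^(bit1 i) sqrt q2. *)
Definition emb_sign1 (i : 'I_4) : algC := if odd i then -1 else 1.
Definition emb_sign2 (i : 'I_4) : algC := if odd i./2 then -1 else 1.

(* sigma_i(x) < 0, for x in K, computed from the rational coordinates of x
   (which are unique). *)
Definition emb_neg (q1 q2 : nat) (i : 'I_4) (x : algC) : bool :=
  `[< exists a b c d : rat,
      x = ratr a + ratr b * sqrtC q1%:R + ratr c * sqrtC q2%:R
          + ratr d * (sqrtC q1%:R * sqrtC q2%:R) /\
      ratr a + emb_sign1 i * ratr b * sqrtC q1%:R + emb_sign2 i * ratr c * sqrtC q2%:R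
          + emb_sign1 i * emb_sign2 i * ratr d * (sqrtC q1%:R * sqrtC q2%:R) < 0 >].

Definition signature (q1 q2 : nat) (x : algC) : 'rV['F_2]_4 :=
  \row_(i < 4) (if emb_neg q1 q2 i x then 1 else 0).

Definition unit_signatures (q1 q2 : nat) : {set 'rV['F_2]_4} :=
  [set v | `[< exists u, is_unit_of (inK q1 q2) u /\ signature q1 q2 u = v >]].

Definition unit_signature_rank (q1 q2 : nat) : nat :=
  \dim <<enum (unit_signatures q1 q2)>>%VS.

Definition deficiency (q1 q2 : nat) : nat := 4 - unit_signature_rank q1 q2.

Definition legendre (a p : nat) : int :=
  if (a %% p == 0)%N then 0
  else if [exists x : 'I_p, (x ^ 2 == a %[mod p])%N] then 1 else -1.

(* Main.v *)
Require Import Defs.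
From HB Require Import structures.
From mathcomp Require Import all_boot all_order all_algebra all_field.
From mathcomp Require Import boolp zify ring.
Import Order.TTheory GRing.Theory Num.Theory.
Local Open Scope ring_scope.
Set Implicit Arguments.
Unset Strict Implicit.
Unset Printing Implicit Defensive.

(** A unit [e > 1] of norm 1 in a real quadratic field with trace [A] satisfies
    [e * (A + 2) = (1 + e) ^ 2], so the square class of [e] is that of the
    integer [A + 2].  Here [(A + 2) * (A - 2) = D * B ^ 2] with nearly coprime
    factors, and congruences modulo 4, 8 and the primes leave a single square
    class: [2] or [2 * q] for [e1] and [e2] (according to [q] modulo 8), and
    [q1] or [q2] for [e3] (according to the Legendre symbol).  Hence
    [sqrt (e1 * e2)] and [sqrt e3] are quotients of totally positive numbers of
    [K] by products of [sqrt q1] and [sqrt q2], which also gives their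
    signatures.  For a unit [u] of [K], [u ^ 2] is a product of relative norms,
    so it equals [e1 ^ a * e2 ^ b * e3 ^ c]; if [b - a] were odd then [e2] would
    be a square in [K], and [sqrt 2] would lie in [K]. *)

(** * Automorphisms negating one square root and fixing another *)

Lemma sqrtC_natK (n : nat) : sqrtC n%:R * sqrtC n%:R = n%:R :> algC.
Proof. by rewrite -expr2 sqrtCK. Qed.

Lemma inQsqrt_poly (n : nat) (p : {poly rat}) :
  inQsqrt n (map_poly ratr p).[sqrtC n%:R].
Proof.
elim/poly_ind: p => [|p c [a [b IH]]].
  by exists 0, 0; rewrite rmorph0 horner0 !rmorph0 mul0r addr0.
exists (b * n%:R + c), a.
rewrite rmorphD rmorphM /= map_polyX map_polyC hornerMXaddC IH.
rewrite rmorphD rmorphM /= rmorph_nat.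
move: (sqrtC_natK n); move: (sqrtC _) => s <-; ring.
Qed.

(** Since [sqrt m] is not in Q([sqrt n]), its minimal polynomial there is X^2 - m, which [- sqrt m]
    also annihilates. The resulting conjugation of Q([sqrt m], [sqrt n]) then extends to all of
    [algC]. *)
Lemma sqrt_aut (m n : nat) : ~ inQsqrt n (sqrtC m%:R) ->
  exists u : {rmorphism algC -> algC},
    u (sqrtC m%:R) = - sqrtC m%:R /\ u (sqrtC n%:R) = sqrtC n%:R.
Proof.
move=> irr.
have [Qn [QnC [s1 Ds genQn]]] := num_field_exists [:: sqrtC n%:R; sqrtC m%:R].
case: s1 Ds genQn => [|b [|a []]] // [Db Da] genQn.
pose E := <<1; b>>%AS.
(* An element of [E] is a polynomial in [b] over the prime field, so its image in [algC] is a
   rational polynomial in [sqrt n], which [inQsqrt_poly] reduces to degree at most 1. *)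
have E'a : a \notin E.
  apply/negP => /Fadjoin_polyP[p p1 Dp]; apply: irr.
  have [q Dq] : exists q : {poly rat}, map_poly QnC p = map_poly ratr q.
    have aP i : p`_i \in 1%VS by apply: (polyOverP p1).
    have a_ i := sig_eqW (vlineP _ _ (aP i)).
    exists (\poly_(i < size p) sval (a_ i)).
    apply/polyP => i; rewrite !coef_map_id0 ?rmorph0 // coef_poly /=.
    case: ltnP => [_|/leq_sizeP/(_ _ (leqnn _)) ->]; last by rewrite !rmorph0.
    by case: (a_ i) => c /= ->; rewrite alg_num_field fmorph_rat.
  rewrite -Da Dp -horner_map Dq Db; exact: inQsqrt_poly.
have a2 : a ^+ 2 = m%:R.
  by apply: (fmorph_inj QnC); rewrite rmorphXn /= Da sqrtCK rmorph_nat.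
have minE : minPoly E a = 'X^2 - m%:R%:P.
  have monE := monic_minPoly E a.
  have mon2 : 'X^2 - m%:R%:P \is @monic Qn by rewrite monicXnsubC.
  have dvdE : minPoly E a %| 'X^2 - m%:R%:P.
    apply: minPoly_dvdp; first by rewrite polyOverXnsubC rpred_nat.
    by rewrite rootE !hornerE a2 subrr.
  apply/eqP; rewrite -eqp_monic // -dvdp_size_eqp // eqn_leq.
  rewrite dvdp_leq ?monic_neq0 //= size_minPoly size_XnsubC // ltnS.
  move: (adjoin_deg_eq1 E a); rewrite (negPf E'a) /adjoin_degree.
  by case: (_.-1).
pose phi := kHomExtend E \1 a (- a).
have root_a : root (map_poly \1%VF (minPoly E a)) (- a).
  rewrite map_poly_id => [|c _]; last by rewrite id_lfunE.
  by rewrite minE rootE !hornerE sqrrN a2 subrr.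
have homphi : kHom E <<E; a>> phi by apply: kHomExtendP; rewrite ?kHom1.
have gen : <<E; a>>%VS = fullv by rewrite -genQn adjoin_cons adjoin_seq1.
have phim : monoid_morphism phi.
  apply/kHom_monoid_morphism; rewrite gen in homphi.
  by apply: (kHomSl _ homphi); apply: sub1v.
pose phimM := GRing.isMonoidMorphism.Build _ _ phi phim.
pose phiRM : {rmorphism _ -> _} := HB.pack (fun_of_lfun phi) phimM.
have [nu Dnu] := extend_algC_subfield_aut QnC phiRM.
exists nu; rewrite -Da -Db -!Dnu /= /phi; split.
  by rewrite (kHomExtend_val (kHom1 1 E)) ?kHom1 // rmorphN.
by rewrite kHomExtend_id ?kHom1 // ?id_lfunE // memv_adjoin.
Qed.

(** * Descent on the trace equations and Legendre symbols *)

Section Arithmetic.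
Local Open Scope nat_scope.

(** Expanding, gcd(m, b)^2 is the gcd of m^2, m b and b^2 = m n, that is, m gcd(m, b, n), and the
    last gcd is 1. *)
Lemma coprime_mul_sqr (m n b : nat) :
  coprime m n -> m * n = b ^ 2 -> m = gcdn m b ^ 2.
Proof.
move=> co mn.
have -> : gcdn m b ^ 2 = gcdn (gcdn (m * m) (m * b)) (gcdn (m * b) (m * n)).
  by rewrite mn -!mulnn muln_gcdr !muln_gcdl [b * m]mulnC.
rewrite -!muln_gcdr -gcdnA [gcdn b (gcdn b n)]gcdnA gcdnn [gcdn b n]gcdnC.
by rewrite gcdnA (eqP co) gcd1n muln1.
Qed.

(** This is the fact that -1 is not a square modulo [q]. The exponent [2 * (q %/ 4).+1] is (q + 1) /
    2: by Fermat it fixes squares, and being even it ignores signs, so X^2 = -Y^2 gives X^2 = Y^2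
    and 2 X^2 = 0. *)
Lemma dvdn_sum_sqr (q x y : nat) :
  prime q -> q %% 4 = 3 -> q %| x ^ 2 + y ^ 2 -> q %| x.
Proof.
move=> pq q4; rewrite !(dvdn_pcharf (pchar_Fp pq)) natrD !natrX.
move: (x%:R%R : 'F_q) (y%:R%R : 'F_q) => X Y; rewrite addr_eq0 => /eqP XY.
have sqr_pow (Z : 'F_q) : ((Z ^+ 2) ^+ (2 * (q %/ 4).+1) = Z ^+ 2)%R.
  rewrite -exprM; have -> : 2 * (2 * (q %/ 4).+1) = q.+1 by lia.
  by rewrite exprS -[X in (_ * _ ^+ X)%R](card_Fp pq) expf_card expr2.
have : (X ^+ 2 + X ^+ 2 == 0)%R.
  rewrite {1}XY -[in X in (_ + X)%R]sqr_pow XY exprM sqrrN -exprM sqr_pow.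
  by rewrite addNr.
rewrite -mulr2n -mulr_natr mulf_eq0 expf_eq0 /= => /orP[//|].
by rewrite -(dvdn_pcharf (pchar_Fp pq)) => /(@dvdn_leq q 2 isT); lia.
Qed.

Lemma not_dvdn_sqr_add4 (q x : nat) :
  prime q -> q %% 4 = 3 -> ~ q %| 2 ^ 2 + x ^ 2.
Proof. by move=> pq q4 /(dvdn_sum_sqr pq q4) /(@dvdn_leq q 2 isT); lia. Qed.

Lemma odd_mod4 (q : nat) : q %% 4 = 3 -> odd q.
Proof. lia. Qed.

Lemma coprime_mul_prime_sqr (q m n b : nat) :
  prime q -> coprime m n -> m * n = q * b ^ 2 ->
  exists s t, (m = s ^ 2 /\ n = q * t ^ 2) \/ (m = q * s ^ 2 /\ n = t ^ 2).
Proof.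
move=> pq co mn; have q0 := prime_gt0 pq.
have : q %| m * n by rewrite mn dvdn_mulr.
rewrite Euclid_dvdM // => /orP[] /dvdnP[k Dk]; subst.
  have [co' mn'] : coprime k n /\ k * n = b ^ 2
    by split; [move: co; rewrite coprimeMl => /andP[]
              | apply/eqP; rewrite -(eqn_pmul2l q0); apply/eqP; lia].
  exists (gcdn k b), (gcdn n b); right; split; rewrite ?[k * q]mulnC.
    by congr muln; apply: coprime_mul_sqr mn'.
  by apply: (@coprime_mul_sqr n k); rewrite 1?coprime_sym // mulnC.
have [co' mn'] : coprime m k /\ m * k = b ^ 2
    by split; [move: co; rewrite coprimeMr => /andP[]
              | apply/eqP; rewrite -(eqn_pmul2l q0); apply/eqP; lia].
exists (gcdn m b), (gcdn k b); left; split; rewrite ?[k * q]mulnC.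
  by apply: coprime_mul_sqr mn'.
by congr muln; apply: (@coprime_mul_sqr k m); rewrite 1?coprime_sym // mulnC.
Qed.

Lemma trace_prime (q A B : nat) :
  prime q -> q %% 4 = 3 -> A ^ 2 = q * B ^ 2 + 4 -> 2 < A ->
  (forall w, A + 2 <> w ^ 2) ->
  exists w, 0 < w /\ ((q %% 8 = 7 /\ A + 2 = 2 * w ^ 2) \/
                      (q %% 8 = 3 /\ A + 2 = 2 * (q * w ^ 2))).
Proof.
move=> pq q4 eqA A2 nsq.
(* Reduction modulo 4 makes [A] even, then parity makes [B] even; the trace equation becomes the
   Pell equation a^2 = q b^2 + 1. *)
have [a Da] : exists a, A = 2 * a.
  exists (A %/ 2); have := divn_eq q 4; rewrite q4 => Dq.
  have := divn_eq A 2; have := divn_eq B 2; move: (ltn_pmod A (isT : 0 < 2)) (ltn_pmod B (isT : 0 < 2)).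
  case: (A %% 2) => [|[|]] // _; first lia.
  by case: (B %% 2) => [|[|]] // _ DB DA; exfalso; move: eqA; rewrite DA DB Dq; nia.
have [b Db] : exists b, B = 2 * b.
  exists (B %/ 2); have := divn_eq q 4; rewrite q4 => Dq.
  have := divn_eq B 2; move: (ltn_pmod B (isT : 0 < 2)).
  case: (B %% 2) => [|[|]] // _; first lia.
  by move=> DB; exfalso; move: eqA; rewrite Da DB Dq; nia.
subst A B.
have eqa : a ^ 2 = q * b ^ 2 + 1 by nia.
(* Odd [a] is impossible: with a = 2c + 1 the consecutive numbers c + 1 and c multiply to q d^2.
   Either c + 1 is a square, and then so is A + 2 = 4 (c + 1), or c is a square t^2 and [q] divides
   t^2 + 1. *)
have [oa|ea] := boolP (odd a).
  have [c Dc] : exists c, a = 2 * c + 1 by exists a./2; have := odd_double_half a; rewrite oa; lia.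
  have [d Dd] : exists d, b = 2 * d.
    exists b./2; have := odd_double_half b; case: (odd b) => /= Db; last lia.
    exfalso; move: eqa; rewrite Dc -Db; have := divn_eq q 4; rewrite q4 => ->; nia.
  subst a b.
  have co : coprime (c + 1) c by rewrite addn1 coprimeSn.
  have mn : (c + 1) * c = q * d ^ 2 by nia.
  have [s [t [[Ds Dt]|[Ds Dt]]]] := coprime_mul_prime_sqr pq co mn.
    by case: (nsq (2 * s)); rewrite expnMn -Ds; lia.
  have : q %| t ^ 2 + 1 ^ 2 by rewrite -Dt exp1n -[c + 1]/(c + 1) Ds dvdn_mulr.
  move=> /[dup] /(dvdn_sum_sqr pq q4) qt.
  rewrite dvdn_addr; last by rewrite -mulnn dvdn_mulr.
  rewrite exp1n dvdn1 => /eqP q1; by rewrite q1 in pq.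
(* For even [a] the factors a + 1 and a - 1 are odd and coprime, and A + 2 = 2 (a + 1). The two ways
   of placing [q] give s^2 = q t^2 + 2 or q s^2 = t^2 + 2 with odd [s] and [t]; modulo 8 the first
   forces 7 and the second forces 3. *)
have [p Dp] : exists p, a = p + 1 by exists a.-1; lia.
subst a; have op : odd p by move: ea; rewrite addn1 /= negbK.
have co : coprime (p + 2) p by rewrite /coprime gcdnC gcdnDl gcdnC -/(coprime 2 p) coprime2n.
have mn : (p + 2) * p = q * b ^ 2 by nia.
have mod8 z : odd z -> z ^ 2 %% 8 = 1.
  move=> oz; have := odd_double_half z; rewrite oz => <-.
  (* The product of two consecutive numbers is even, which supplies the factor 8 of z^2 - 1. *)
  have : exists k, (z./2) * (z./2).+1 = 2 * k.
    exists ((z./2) * (z./2).+1)./2; have := odd_double_half ((z./2) * (z./2).+1).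
    rewrite oddM /= andbN; lia.
  case=> k Dk; rewrite (_ : (true + _) ^ 2 = k * 8 + 1) ?modnMDl //; nia.
have [s [t [[Ds Dt]|[Ds Dt]]]] := coprime_mul_prime_sqr pq co mn.
  exists s; split; first by case: s Ds => //; lia.
  left; split; last by rewrite -Ds; lia.
  have os : odd s by have := congr1 odd Ds; rewrite oddX /= oddD op.
  have ot : odd t.
    by have := congr1 odd Dt; rewrite oddM oddX op; case: (odd t) => //; rewrite andbF.
  have : (q * t ^ 2 + 2) %% 8 = 1 by rewrite -Dt Ds mod8.
  by rewrite -modnDml -modnMmr mod8 // muln1 modnDml; lia.
exists s; split; first by case: s Ds => //; lia.
right; split; last by rewrite -Ds; lia.
have ot : odd t by have := congr1 odd Dt; rewrite oddX op.
have os : odd s.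
  by have := congr1 odd Ds; rewrite oddM oddX oddD op; case: (odd s) => //; rewrite andbF.
have : (q * s ^ 2) %% 8 = (t ^ 2 + 2) %% 8 by rewrite -Ds Dt.
by rewrite -modnMmr mod8 // -[RHS]modnDml mod8 // muln1.
Qed.

(** The primes [q1] and [q2] are distributed between A + 2 and A - 2. Both in A - 2 would make A + 2
    a square; both in A + 2 would make A - 2 a square, so that [q1] divides a sum of a square and 4.
    Only the split distributions survive. *)
Lemma trace_prod (q1 q2 A B : nat) :
  prime q1 -> prime q2 -> q1 %% 4 = 3 -> q2 %% 4 = 3 ->
  A ^ 2 = q1 * q2 * B ^ 2 + 4 -> 2 < A -> (forall w, A + 2 <> w ^ 2) ->
  exists w z, (A + 2 = q1 * w ^ 2 /\ A = q2 * z ^ 2 + 2) \/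
              (A + 2 = q2 * w ^ 2 /\ A = q1 * z ^ 2 + 2).
Proof.
move=> p1 p2 q14 q24 eqA A2 nsq.
have q0 := prime_gt0 p1.
(* The common square factor is j^2, with j = 1 for odd [A] and j = 2 for even [A]. In the even case
   q1 q2 = 1 modulo 4 forces A = 4c + 2, and the coprime factors are c + 1 and c. *)
have [j [m [n [b [j2 co mn Am An]]]]] : exists j m n b, [/\ j %| 2, coprime m n,
    m * n = q1 * q2 * b ^ 2, A + 2 = m * j ^ 2 & A = n * j ^ 2 + 2].
  have D4 : (q1 * q2) %% 4 = 1 by rewrite -modnMml q14 -modnMmr q24.
  have [oA|eA] := boolP (odd A).
    exists 1, (A + 2), (A - 2), B; split; rewrite ?muln1 //; try lia.
    rewrite /coprime; have -> : A + 2 = A - 2 + 4 by lia.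
    rewrite gcdnC gcdnDl gcdnC -/(coprime (2 ^ 2) _) coprimeXl // coprime2n.
    by rewrite oddB ?oA //; lia.
  have [a Da] : exists a, A = 2 * a by exists (A %/ 2); lia.
  have := divn_eq (q1 * q2) 4; rewrite D4; move: eqA; move: (q1 * q2) => D eqA DD.
  have [b Db] : exists b, B = 2 * b.
    have [oB|eB] := boolP (odd B); last by exists (B %/ 2); lia.
    have [b Db] : exists b, B = 2 * b + 1 by exists (B %/ 2); lia.
    by exfalso; move: eqA; rewrite Da Db DD; nia.
  subst A B; have eqa : a ^ 2 = D * b ^ 2 + 1 by nia.
  have [d Dd] : exists d, b = 2 * d.
    have [ob|eb] := boolP (odd b); last by exists (b %/ 2); lia.
    have [d Dd] : exists d, b = 2 * d + 1 by exists (b %/ 2); lia.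
    exfalso; have [c [Dc|Dc]] : exists c, a = 2 * c \/ a = 2 * c + 1 by exists (a %/ 2); lia.
      by move: eqa; rewrite Dc Dd DD; nia.
    by move: eqa; rewrite Dc Dd DD; nia.
  have [c Dc] : exists c, a = 2 * c + 1.
    have [oa|ea] := boolP (odd a); first by exists (a %/ 2); lia.
    have [c Dc] : exists c, a = 2 * c by exists (a %/ 2); lia.
    by exfalso; move: eqa; rewrite Dc Dd; nia.
  subst a b; exists 2, c.+1, c, d; split=> //; first exact: coprimeSn; nia.
have fin x y s t : m = x * s ^ 2 -> n = y * t ^ 2 ->
    A + 2 = x * (s * j) ^ 2 /\ A = y * (t * j) ^ 2 + 2.
  by move=> Dm Dn; rewrite Am An Dm Dn !expnMn !mulnA.
have : q1 %| m * n by rewrite mn -mulnA dvdn_mulr.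
rewrite Euclid_dvdM // => /orP[] /dvdnP[k Dk].
  have co' : coprime k n by move: co; rewrite Dk coprimeMl => /andP[].
  have mn' : k * n = q2 * b ^ 2.
    apply/eqP; rewrite -(eqn_pmul2l q0); apply/eqP.
    by rewrite mulnA [RHS]mulnA -mn Dk [q1 * k]mulnC.
  have [s [t [[Ds Dt]|[Ds Dt]]]] := coprime_mul_prime_sqr p2 co' mn'.
    by exists (s * j), (t * j); left; apply: fin => //; rewrite Dk Ds mulnC.
  have [_ An'] : A + 2 = q1 * q2 * (s * j) ^ 2 /\ A = 1 * (t * j) ^ 2 + 2.
    by apply: fin; rewrite ?mul1n // Dk Ds mulnC mulnA.
  have : q1 %| 2 ^ 2 + (t * j) ^ 2.
    have -> : 2 ^ 2 + (t * j) ^ 2 = A + 2 by rewrite An'; lia.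
    by rewrite Am Dk -mulnA mulnC -mulnA dvdn_mulr // dvdn_mull.
  by move/(not_dvdn_sqr_add4 p1 q14).
have co' : coprime m k by move: co; rewrite Dk coprimeMr => /andP[].
have mn' : m * k = q2 * b ^ 2.
  apply/eqP; rewrite -(eqn_pmul2l q0); apply/eqP.
  by rewrite mulnA [RHS]mulnA -mn Dk; ring.
have [s [t [[Ds Dt]|[Ds Dt]]]] := coprime_mul_prime_sqr p2 co' mn'.
  by case: (nsq (s * j)); rewrite Am Ds expnMn.
by exists (s * j), (t * j); right; apply: fin => //; rewrite Dk Dt mulnC.
Qed.

(** Modulo [q2] the equation reads q1 w^2 = 4, and [w] is invertible because [q2] does not divide 4.
    With [v] inverse to [w], 2v is a square root of [q1]. *)
Lemma legendre_eq1 (q1 q2 w z : nat) :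
  prime q1 -> prime q2 -> q1 != q2 -> q2 %% 4 = 3 ->
  q1 * w ^ 2 = q2 * z ^ 2 + 4 -> legendre q1 q2 = 1%R.
Proof.
move=> p1 p2 neq q24 eqw; have q2gt := prime_gt0 p2.
have n21 : ~~ (q2 %| q1) by rewrite dvdn_prime2 // eq_sym.
have n2w : coprime q2 w.
  rewrite prime_coprime //; apply/negP => q2w.
  have : q2 %| 2 ^ 2.
    rewrite -(@dvdn_addr (q2 * z ^ 2)) ?dvdn_mulr // -eqw.
    by rewrite dvdn_mull // -mulnn dvdn_mulr.
  by rewrite Euclid_dvdX // andbT => /(@dvdn_leq q2 2 isT); lia.
rewrite /legendre -/(q2 %| q1) (negPf n21).
have [v _ /eqP Dv] : exists2 v, true & v * w %% q2 == 1.
  have w0 : 0 < w by case: (w) eqw => //; lia.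
  case: (egcdnP q2 w0) => v l e _; exists v => //.
  move: n2w; rewrite coprime_sym /coprime => /eqP g; rewrite e g.
  by rewrite -modnDml modnMl add0n modn_small // prime_gt1.
have sq : (2 * v) ^ 2 = q1 %[mod q2].
  have -> : (2 * v) ^ 2 = 4 * v ^ 2 by rewrite expnMn.
  have h : q1 * w ^ 2 = 4 %[mod q2] by rewrite eqw -modnDml modnMr add0n.
  rewrite -modnMml -h modnMml -mulnA -expnMn [w * v]mulnC.
  by rewrite -modnMmr -modnXm Dv exp1n [1 %% q2]modn_small ?prime_gt1 // muln1.
case: existsP => // [[]]; exists (Ordinal (ltn_pmod (2 * v) q2gt)) => /=.
by rewrite modnXm sq.
Qed.

(** A square root [x] of [q1] modulo [q2] would make [q2] divide 2^2 + (x z)^2. *)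
Lemma legendre_eqN1 (q1 q2 w z : nat) :
  prime q1 -> prime q2 -> q1 != q2 -> q2 %% 4 = 3 ->
  q2 * w ^ 2 = q1 * z ^ 2 + 4 -> legendre q1 q2 = (-1)%R.
Proof.
move=> p1 p2 neq q24 eqw.
have n21 : ~~ (q2 %| q1) by rewrite dvdn_prime2 // eq_sym.
rewrite /legendre -/(q2 %| q1) (negPf n21).
case: existsP => // [[x /eqP xq]].
have : q2 %| 2 ^ 2 + (x * z) ^ 2.
  rewrite /dvdn expnMn -modnDmr -modnMml xq modnMml modnDmr.
  by rewrite addnC -[2 ^ 2]/4 -eqw modnMr.
by move/(not_dvdn_sqr_add4 p2 q24).
Qed.

End Arithmetic.

(** * Integrality and rational squares *)

Lemma Aint_sqrt (x : algC) : x ^+ 2 \in Aint -> x \in Aint.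
Proof.
move=> Ax2; have [p [Dp monp] _] := minCpolyP (x ^+ 2).
have pZ : minCpoly (x ^+ 2) \is a polyOver Num.int by [].
(* If P is the minimal polynomial of x^2, then P(X^2) is monic and integral with root x. *)
apply: (@root_monic_Aint (minCpoly (x ^+ 2) \Po 'X^2)).
- by rewrite /root horner_comp !hornerE; apply: root_minCpoly.
- rewrite monicE lead_coef_comp ?size_polyXn //.
  by rewrite (monicP (minCpoly_monic _)) lead_coefXn expr1n mulr1.
- by rewrite polyOver_comp // polyOverXn.
Qed.

(** In lowest terms the square of the denominator is prime to the numerator, so it divides [D]; [D]
    being square-free, [r] is an integer. *)
Lemma rat_sqr_nat (D n : nat) (r : rat) :
  (forall k, (k ^ 2 %| D)%N -> k = 1%N) -> n%:R = D%:R * r ^+ 2 ->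
  exists b, n = (D * b ^ 2)%N.
Proof.
move=> sqf Dn.
have E : (n * `|denq r| ^ 2 = D * `|numq r| ^ 2)%N.
  have E : n%:Z * denq r ^+ 2 = D%:Z * numq r ^+ 2.
    apply: (@intr_inj rat); rewrite !intrM [n%:~R]Dn -{1}(divq_num_den r); field.
    by rewrite intr_eq0 denq_neq0.
  have := congr1 absz E; rewrite !expr2 !abszM -!mulnn; lia.
have k1 : `|denq r|%N = 1%N.
  apply: sqf; rewrite -(@Gauss_dvdl _ _ (`|numq r| ^ 2)).
    by rewrite -E dvdn_mull.
  by rewrite coprimeXl // coprimeXr // coprime_sym coprime_num_den.
by exists `|numq r|%N; rewrite -E k1 muln1.
Qed.

Lemma int_unit (N : algC) :
  N \in Num.int -> N^-1 \in Num.int -> N != 0 -> N = 1 \/ N = -1.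
Proof.
move=> /intrP[n ->] /intrP[m Dm] n0.
have : (n * m)%:~R = 1 :> algC by rewrite intrM -Dm mulfV.
move/(@intr_inj _ (n * m) 1) => /(congr1 absz)/eqP; rewrite abszM muln_eq1.
case/andP=> /eqP n1 _; have [->|->] : n = 1 \/ n = -1 by lia.
  by left.
by right.
Qed.

(** * Norm and trace of units in a real quadratic field *)

Section QuadraticUnit.
Variables (D q : nat) (u : {rmorphism algC -> algC}).
Hypotheses (pq : prime q) (q4 : (q %% 4 = 3)%N) (qD : (q %| D)%N).
Hypothesis sqf : forall k, (k ^ 2 %| D)%N -> k = 1%N.
Hypothesis uD : u (sqrtC D%:R) = - sqrtC D%:R.

(** Norm and trace are rational algebraic integers, hence integers, and the norm is 1 or -1. Norm -1
    would give t^2 + 4 = D c^2, so that [q] would divide a sum of a square and 2^2. *)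
Lemma quad_unit_norm (v : algC) : is_unit_of (inQsqrt D) v ->
  v * u v = 1 /\ exists t : int, v + u v = t%:~R /\ exists b, (`|t| ^ 2 = D * b ^ 2 + 4)%N.
Proof.
case=> [[a [b Dv]] [v0 [Av Av']]].
have Duv : u v = ratr a - ratr b * sqrtC D%:R.
  by rewrite Dv rmorphD (rmorphM u (ratr b)) !(fmorph_rat u) uD mulrN.
have DT : v + u v = ratr (2%:R * a).
  by rewrite Duv Dv !CratrE; ring.
have DN : v * u v = ratr (a ^+ 2 - D%:R * b ^+ 2).
  rewrite Duv Dv !CratrE.
  by move: (sqrtC_natK D); move: (sqrtC _) => s <-; ring.
have TZ : v + u v \in Num.int.
  apply: Cint_rat_Aint; first by rewrite DT Crat_rat.
  by rewrite rpredD // Aint_aut.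
have uv0 : u v != 0 by rewrite fmorph_eq0.
have NZ : v * u v \in Num.int.
  by apply: Cint_rat_Aint; [rewrite DN Crat_rat | rewrite rpredM // Aint_aut].
have NZ' : (v * u v)^-1 \in Num.int.
  apply: Cint_rat_Aint; first by rewrite DN -fmorphV Crat_rat.
  by rewrite invfM -fmorphV rpredM // Aint_aut.
have /intrP[t Dt] := TZ.
have TN : ratr (t%:~R ^+ 2) = ratr (D%:R * (2%:R * b) ^+ 2) + 4%:R * (v * u v) :> algC.
  rewrite rmorphXn rmorph_int -Dt DT DN -[4%:R](rmorph_nat ratr) -rmorphXn -rmorphM -rmorphD.
  by congr ratr; ring.
have absT : (`|t| ^ 2)%N%:R = t%:~R ^+ 2 :> rat.
  by rewrite natrX natr_absz intr_norm real_normK ?num_real.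
have [N1|N1] := int_unit NZ NZ' (mulf_neq0 v0 uv0).
  split=> //; exists t; split=> //.
  have E : t%:~R ^+ 2 = D%:R * (2%:R * b) ^+ 2 + 4%:R :> rat.
    apply: (fmorph_inj (ratr : {rmorphism rat -> algC})).
    by rewrite /= TN N1 rmorphD /= rmorph_nat mulr1.
  (* This bound makes the truncated subtraction of 4 below exact. *)
  have t4 : (4 <= `|t| ^ 2)%N.
    rewrite -(ler_nat rat) absT E lerDr mulr_ge0 ?ler0n //.
    by rewrite sqr_ge0.
  have [c Dc] : exists c, (`|t| ^ 2 - 4 = D * c ^ 2)%N.
    by apply: (@rat_sqr_nat _ _ (2%:R * b)) => //; rewrite natrB // absT E addrK.
  by exists c; rewrite -Dc subnK.
exfalso.
have E : (`|t| ^ 2 + 4)%N%:R = D%:R * (2%:R * b) ^+ 2 :> rat.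
  rewrite natrD absT; apply: (fmorph_inj (ratr : {rmorphism rat -> algC})).
  by rewrite /= rmorphD /= TN N1 rmorph_nat; ring.
have [c Dc] := rat_sqr_nat sqf E.
have : (q %| 2 ^ 2 + `|t| ^ 2)%N by rewrite addnC Dc dvdn_mulr.
by move/(not_dvdn_sqr_add4 pq q4).
Qed.

Lemma inQsqrt_add1_div (m : nat) (x : algC) (w : nat) :
  inQsqrt m x -> inQsqrt m ((1 + x) / w%:R).
Proof.
case=> a [b ->]; exists ((1 + a) / w%:R), (b / w%:R).
by rewrite !fmorph_div /= rmorphD rmorph1 !rmorph_nat; ring.
Qed.

(** If A + 2 were w^2, then e would be the square of (1 + e) / w, itself a unit of the field,
    against the minimality of a fundamental unit. *)
Lemma fund_unit_trace (e : algC) : is_fund_unit_quad D e ->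
  exists A B, [/\ u e = e^-1, e + e^-1 = A%:R, (A ^ 2 = D * B ^ 2 + 4)%N,
    (2 < A)%N & forall w, (A + 2 <> w ^ 2)%N].
Proof.
move=> [eU [e1 fund]].
have e_gt0 : 0 < e by apply: lt_trans e1; rewrite ltr01.
have e0 : e != 0 by rewrite gt_eqF.
have [N1 [t [Dt [B DB]]]] := quad_unit_norm eU.
have ue : u e = e^-1 by apply: (mulfI e0); rewrite N1 mulfV.
have T2 : 2%:R < e + e^-1.
  rewrite -subr_gt0; have -> : e + e^-1 - 2%:R = (e - 1) ^+ 2 / e by field.
  by rewrite divr_gt0 // exprn_gt0 // subr_gt0.
have [A DA] : exists A : nat, t = A.
  exists `|t|%N; rewrite gez0_abs // -(ler_int algC) -Dt ue.
  by apply: le_trans (ltW T2); rewrite ler0n.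
subst t; exists A, B; split; rewrite -?ue //.
  by rewrite -(ltr_nat algC) -[A%:R]Dt ue.
move=> w Dw.
have Ew : e = ((1 + e) / w%:R) ^+ 2.
  have w2 : e + e^-1 + 2%:R = w%:R ^+ 2 by rewrite -ue Dt -natrX -Dw natrD.
  have w0 : w%:R != 0 :> algC.
    have : w%:R ^+ 2 != 0 :> algC.
      by rewrite -w2 gt_eqF // addr_gt0 ?ltr0n // (lt_trans _ T2) ?ltr0n.
    by rewrite expf_eq0.
  rewrite expr_div_n -w2; field; rewrite e0 /=.
  by rewrite (_ : _ + _ = (1 + e) ^+ 2) ?expf_neq0 ?gt_eqF ?addr_gt0 ?ltr01 //; ring.
set f := _ / _ in Ew.
have fU : is_unit_of (inQsqrt D) f.
  case: eU => [eQ [_ [Ae Ae']]]; split; first exact: inQsqrt_add1_div.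
  split; first by apply: contraNneq e0 => f0; rewrite Ew f0 expr0n.
  by split; apply: Aint_sqrt; rewrite ?exprVn -Ew.
have [k Dk] := fund _ fU.
(* The unit [f] is e^k up to sign and squares to e, so e^(2k - 1) = 1; an odd exponent is nonzero,
   while e > 1. *)
have : e ^ (k *+ 2 - 1) = 1.
  rewrite expfzDr // exprN1 mulr2n expfzDr //.
  have -> : e ^ k * e ^ k = e by rewrite {3}Ew; case: Dk => ->; rewrite ?sqrrN expr2.
  by rewrite mulfV.
move/eqP; rewrite pexprz_eq1 ?(ltW e_gt0) // (gt_eqF e1) orbF; lia.
Qed.

End QuadraticUnit.

(** * Square-free numbers and independence of the two square roots *)

Lemma prime_sqf (p k : nat) : prime p -> (k ^ 2 %| p)%N -> k = 1%N.
Proof.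
move=> pp kp; have /primeP[p1 h] := pp.
have := h k (dvdn_trans (dvdn_exp _ (dvdnn k)) kp); case/(_ isT)/orP => /eqP // Dk.
move: kp; rewrite Dk -mulnn => /dvdn_leq; rewrite prime_gt0 // => /(_ isT); nia.
Qed.

Lemma prime_mul_sqf (p q k : nat) :
  prime p -> prime q -> p != q -> (k ^ 2 %| p * q)%N -> k = 1%N.
Proof.
move=> pp pq npq; rewrite -mulnn => kpq.
have [|k1] := ltnP 1 k; last first.
  case: k k1 kpq => [|[|]] // _; rewrite dvd0n muln_eq0.
  by rewrite !eqn0Ngt !prime_gt0.
move=> /pdiv_prime; have := pdiv_dvd k; move: (pdiv k) => l lk pl.
have llpq : (l * l %| p * q)%N by apply: dvdn_trans kpq; apply: dvdn_mul.
have : (l %| p * q)%N by apply: dvdn_trans llpq; rewrite dvdn_mulr.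
rewrite Euclid_dvdM // !dvdn_prime2 // => /orP[] /eqP Dl; move: llpq; rewrite Dl.
  by rewrite dvdn_pmul2l ?prime_gt0 // dvdn_prime2 // (negPf npq).
by rewrite dvdn_pmul2r ?prime_gt0 // dvdn_prime2 // eq_sym (negPf npq).
Qed.

Lemma prime_not_sqr (p : nat) (r : rat) : prime p -> p%:R <> r ^+ 2.
Proof.
move=> pp Dp; have sqf1 k : (k ^ 2 %| 1)%N -> k = 1%N.
  by rewrite dvdn1 -mulnn muln_eq1 andbb => /eqP.
have [|b Db] := @rat_sqr_nat 1 p r sqf1; first by rewrite mul1r.
have : (b ^ 2 %| p)%N by rewrite Db mul1n.
by move/(prime_sqf pp) => b1; rewrite Db b1 in pp.
Qed.

Lemma prime_sqrt_irrat (p : nat) (r : rat) : prime p -> (sqrtC p%:R : algC) <> ratr r.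
Proof.
move=> pp Dp; apply: (@prime_not_sqr p r pp).
apply: (fmorph_inj (ratr : {rmorphism rat -> algC})).
by rewrite /= rmorphXn /= -Dp sqrtCK rmorph_nat.
Qed.

(** Squaring [sqrt p] = a + b [sqrt q] shows that 2ab [sqrt q] is rational, so a or b vanishes. Then
    p = q b^2, and [q] divides [p], or p = a^2. *)
Lemma sqrt_notin_Qsqrt (p q : nat) : prime p -> prime q -> p != q ->
  ~ inQsqrt q (sqrtC p%:R).
Proof.
move=> pp pq npq [a [b Dp]].
have E : ratr (p%:R - a ^+ 2 - q%:R * b ^+ 2) = ratr (2%:R * a * b) * sqrtC q%:R :> algC.
  rewrite !CratrE -[p%:R](sqrtCK p%:R) Dp.
  by move: (sqrtC_natK q); move: (sqrtC q%:R) => s <-; ring.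
have [ab0|ab0] := eqVneq (2%:R * a * b) 0; last first.
  apply: (@prime_sqrt_irrat q ((p%:R - a ^+ 2 - q%:R * b ^+ 2) / (2%:R * a * b)) pq).
  by rewrite fmorph_div /= E mulrAC mulfV ?mul1r // fmorph_eq0.
move: E; rewrite ab0 rmorph0 mul0r => /eqP; rewrite fmorph_eq0 => /eqP E.
move/eqP: ab0; rewrite !mulf_eq0 pnatr_eq0 /= => /orP[] /eqP z0.
  have Eq : p%:R = q%:R * b ^+ 2 by apply/eqP; rewrite -subr_eq0 -{}E z0; apply/eqP; ring.
  have [k|c Dc] := rat_sqr_nat _ Eq; first exact: prime_sqf.
  have : (q %| p)%N by rewrite Dc dvdn_mulr.
  by rewrite dvdn_prime2 // eq_sym (negPf npq).
apply: (@prime_not_sqr p a pp).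
by apply/eqP; rewrite -subr_eq0 -{}E z0; apply/eqP; ring.
Qed.

(** * The field K: arithmetic, conjugations and fixed fields *)

Section Biquadratic.
Variables (q1 q2 : nat) (u1 u2 : {rmorphism algC -> algC}).
Local Notation r1 := (sqrtC q1%:R : algC).
Local Notation r2 := (sqrtC q2%:R : algC).
Local Notation inK := (inK q1 q2).
Hypotheses (u1r1 : u1 r1 = - r1) (u1r2 : u1 r2 = r2).
Hypotheses (u2r1 : u2 r1 = r1) (u2r2 : u2 r2 = - r2).

Lemma aut1_coord (a b c d : rat) :
  u1 (ratr a + ratr b * r1 + ratr c * r2 + ratr d * (r1 * r2))
  = ratr a - ratr b * r1 + ratr c * r2 - ratr d * (r1 * r2).
Proof.
rewrite 3!rmorphD (rmorphM u1 (ratr b)) (rmorphM u1 (ratr c)) (rmorphM u1 (ratr d)).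
by rewrite !(fmorph_rat u1) (rmorphM u1 r1) u1r1 u1r2; ring.
Qed.

Lemma aut2_coord (a b c d : rat) :
  u2 (ratr a + ratr b * r1 + ratr c * r2 + ratr d * (r1 * r2))
  = ratr a + ratr b * r1 - ratr c * r2 - ratr d * (r1 * r2).
Proof.
rewrite 3!rmorphD (rmorphM u2 (ratr b)) (rmorphM u2 (ratr c)) (rmorphM u2 (ratr d)).
by rewrite !(fmorph_rat u2) (rmorphM u2 r1) u2r1 u2r2; ring.
Qed.

Lemma inK_rat a : inK (ratr a).
Proof. by exists a, 0, 0, 0; rewrite rmorph0 !mul0r !addr0. Qed.

Lemma inK_nat n : inK n%:R.
Proof. by rewrite -(rmorph_nat (ratr : {rmorphism rat -> algC})); apply: inK_rat. Qed.

Lemma inK_r1 : inK r1.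
Proof. by exists 0, 1, 0, 0; rewrite rmorph0 rmorph1 !mul0r !addr0 add0r mul1r. Qed.

Lemma inK_r2 : inK r2.
Proof. by exists 0, 0, 1, 0; rewrite rmorph0 rmorph1 !mul0r !addr0 add0r mul1r. Qed.

Lemma inK_opp x : inK x -> inK (- x).
Proof.
by case=> a [b [c [d ->]]]; exists (- a), (- b), (- c), (- d); rewrite !CratrE; ring.
Qed.

Lemma inK_add x y : inK x -> inK y -> inK (x + y).
Proof.
case=> a [b [c [d ->]]] [a' [b' [c' [d' ->]]]].
by exists (a + a'), (b + b'), (c + c'), (d + d'); rewrite !CratrE; ring.
Qed.

Lemma inK_mul x y : inK x -> inK y -> inK (x * y).
Proof.
case=> a [b [c [d ->]]] [a' [b' [c' [d' ->]]]].
exists (a * a' + q1%:R * b * b' + q2%:R * c * c' + q1%:R * q2%:R * d * d'),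
  (a * b' + b * a' + q2%:R * (c * d' + d * c')),
  (a * c' + c * a' + q1%:R * (b * d' + d * b')),
  (a * d' + d * a' + b * c' + c * b').
rewrite !CratrE; move: (sqrtC_natK q1) (sqrtC_natK q2).
by move: r1 r2 => s1 s2 <- <-; ring.
Qed.

Lemma inK_aut1 x : inK x -> inK (u1 x).
Proof.
by case=> a [b [c [d ->]]]; exists a, (- b), c, (- d); rewrite aut1_coord !CratrE; ring.
Qed.

Lemma inK_aut2 x : inK x -> inK (u2 x).
Proof.
by case=> a [b [c [d ->]]]; exists a, b, (- c), (- d); rewrite aut2_coord !CratrE; ring.
Qed.

Lemma aut1K x : inK x -> u1 (u1 x) = x.
Proof.
case=> a [b [c [d ->]]]; rewrite aut1_coord.
have -> : ratr a - ratr b * r1 + ratr c * r2 - ratr d * (r1 * r2) =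
  ratr a + ratr (- b) * r1 + ratr c * r2 + ratr (- d) * (r1 * r2) by rewrite !CratrE; ring.
by rewrite aut1_coord !CratrE; ring.
Qed.

Lemma aut2K x : inK x -> u2 (u2 x) = x.
Proof.
case=> a [b [c [d ->]]]; rewrite aut2_coord.
have -> : ratr a + ratr b * r1 - ratr c * r2 - ratr d * (r1 * r2) =
  ratr a + ratr b * r1 + ratr (- c) * r2 + ratr (- d) * (r1 * r2) by rewrite !CratrE; ring.
by rewrite aut2_coord !CratrE; ring.
Qed.

Lemma aut12C x : inK x -> u2 (u1 x) = u1 (u2 x).
Proof.
case=> a [b [c [d ->]]]; rewrite aut1_coord aut2_coord.
have -> : ratr a - ratr b * r1 + ratr c * r2 - ratr d * (r1 * r2) =
  ratr a + ratr (- b) * r1 + ratr c * r2 + ratr (- d) * (r1 * r2) by rewrite !CratrE; ring.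
have -> : ratr a + ratr b * r1 - ratr c * r2 - ratr d * (r1 * r2) =
  ratr a + ratr b * r1 + ratr (- c) * r2 + ratr (- d) * (r1 * r2) by rewrite !CratrE; ring.
by rewrite aut1_coord aut2_coord !CratrE; ring.
Qed.

Lemma sqrtC_mul12 : sqrtC (q1 * q2)%:R = r1 * r2.
Proof. by rewrite natrM rootCMl ?ler0n. Qed.

Lemma addrr_inj (x y : algC) : x + x = y + y -> x = y.
Proof.
have two : (2%:R : algC) != 0 by rewrite pnatr_eq0.
by move=> h; apply: (mulIf two); rewrite !mulr_natr !mulr2n.
Qed.

Lemma inQsqrt1_inK x : inQsqrt q1 x -> inK x.
Proof. by case=> a [b ->]; exists a, b, 0, 0; rewrite rmorph0; ring. Qed.

Lemma inQsqrt2_inK x : inQsqrt q2 x -> inK x.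
Proof. by case=> a [b ->]; exists a, 0, b, 0; rewrite rmorph0; ring. Qed.

Lemma inQsqrt12_inK x : inQsqrt (q1 * q2) x -> inK x.
Proof. by case=> a [b ->]; exists a, 0, 0, b; rewrite rmorph0 sqrtC_mul12; ring. Qed.

(** In x + x = u2 x + x the coordinates negated by [u2] cancel; halving leaves the quadratic part.
    The next two lemmas use the same averaging. *)
Lemma aut2_fixed x : inK x -> u2 x = x -> inQsqrt q1 x.
Proof.
case=> a [b [c [d ->]]] h; exists a, b; apply: addrr_inj; rewrite -{1}h.
by rewrite aut2_coord; ring.
Qed.

Lemma aut1_fixed x : inK x -> u1 x = x -> inQsqrt q2 x.
Proof.
case=> a [b [c [d ->]]] h; exists a, c; apply: addrr_inj; rewrite -{1}h.
by rewrite aut1_coord; ring.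
Qed.

Lemma aut12_fixed x : inK x -> u1 (u2 x) = x -> inQsqrt (q1 * q2) x.
Proof.
case=> a [b [c [d ->]]] h; exists a, d; apply: addrr_inj; rewrite sqrtC_mul12 -{1}h.
rewrite aut2_coord.
have -> : ratr a + ratr b * r1 - ratr c * r2 - ratr d * (r1 * r2) =
  ratr a + ratr b * r1 + ratr (- c) * r2 + ratr (- d) * (r1 * r2) by rewrite !CratrE; ring.
by rewrite aut1_coord !CratrE; ring.
Qed.

(** The inverse is the product of the other three conjugates divided by the norm. The norm is taken
    in two stages: w = x (u2 x) lies in Q([sqrt q1]), and w (u1 w) is rational. *)
Lemma inK_inv x : inK x -> inK x^-1.
Proof.
move=> xK; have [->|x0] := eqVneq x 0; first by rewrite invr0; apply: (inK_nat 0).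
have x2K := inK_aut2 xK; have wK := inK_mul xK x2K; set w := x * u2 x in wK.
have w0 : w != 0 by rewrite mulf_neq0 ?fmorph_eq0.
have u2w : u2 w = w by rewrite rmorphM aut2K // mulrC.
have [a [b Dw]] := aut2_fixed wK u2w.
have u1w : u1 w = ratr a - ratr b * r1.
  rewrite Dw; have := aut1_coord a b 0 0; rewrite rmorph0.
  by rewrite !mul0r !addr0 subr0.
have DN : w * u1 w = ratr (a ^+ 2 - q1%:R * b ^+ 2).
  rewrite u1w Dw !CratrE; move: (sqrtC_natK q1); move: r1 => s <-; ring.
have -> : x^-1 = u2 x * u1 w * ratr (a ^+ 2 - q1%:R * b ^+ 2)^-1.
  rewrite (fmorphV (ratr : {rmorphism rat -> algC})) /= -DN; apply: (mulfI x0); rewrite mulfV // !mulrA -/w mulfV //.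
  by rewrite mulf_neq0 ?fmorph_eq0.
by apply: inK_mul; [apply: inK_mul => //; apply: inK_aut1 | apply: inK_rat].
Qed.

Lemma inK_exprz x (k : int) : inK x -> inK (x ^ k).
Proof.
move=> xK; have h (n : nat) : inK (x ^+ n).
  by elim: n => [|n IH]; [apply: (inK_nat 1) | rewrite exprS; apply: inK_mul].
by case: k => n; [apply: h | apply: inK_inv; apply: h].
Qed.

Lemma inK_real x : inK x -> x \is Num.real.
Proof.
have rr a : (ratr a : algC) \is Num.real by rewrite Creal_Crat // Crat_rat.
have nr n : (sqrtC n%:R : algC) \is Num.real by rewrite ger0_real // sqrtC_ge0 ler0n.
case=> a [b [c [d ->]]]; by do ?[exact: rr | exact: nr | apply: rpredD | apply: rpredM].
Qed.

End Biquadratic.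

(** * Real embeddings and signatures *)

Section Emb.
Variables (q1 q2 : nat) (u1 u2 : {rmorphism algC -> algC}).
Local Notation r1 := (sqrtC q1%:R : algC).
Local Notation r2 := (sqrtC q2%:R : algC).
Local Notation inK := (inK q1 q2).
Hypotheses (u1r1 : u1 r1 = - r1) (u1r2 : u1 r2 = r2).
Hypotheses (u2r1 : u2 r1 = r1) (u2r2 : u2 r2 = - r2).

Lemma aut_fixed_rat x : inK x -> u1 x = x -> u2 x = x -> exists a, x = ratr a.
Proof.
move=> xK x1 x2; have [a [b Dx]] := aut2_fixed u2r1 u2r2 xK x2.
exists a; apply: addrr_inj; rewrite -{1}x1 Dx.
have := aut1_coord u1r1 u1r2 a b 0 0.
by rewrite rmorph0 !mul0r !addr0 subr0 => ->; ring.
Qed.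

(** Each conjugation maps [z] to itself or its negative. Multiplying by the radicals whose
    conjugation negates [z] gives a rational number whose square is twice an odd number, which is
    impossible. *)
Lemma sqrt2_notin_K z : odd q1 -> odd q2 -> inK z -> z ^+ 2 <> 2%:R.
Proof.
move=> o1 o2 zK z2.
have sgn (u : {rmorphism algC -> algC}) : exists s : bool, u z = (-1) ^+ s * z.
  have : u z ^+ 2 == z ^+ 2 by rewrite -rmorphXn z2 rmorph_nat.
  rewrite eqf_sqr => /orP[] /eqP ->; first by exists false; rewrite mul1r.
  by exists true; rewrite mulN1r.
have [s1 Ds1] := sgn u1; have [s2 Ds2] := sgn u2.
pose w := z * r1 ^+ s1 * r2 ^+ s2.
have wK : inK w.
  apply: inK_mul; first apply: inK_mul => //.
    by case: (s1); [apply: inK_r1 | apply: (inK_nat _ _ 1)].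
  by case: (s2); [apply: inK_r2 | apply: (inK_nat _ _ 1)].
have w1 : u1 w = w.
  rewrite /w !rmorphM !rmorphXn u1r1 u1r2 Ds1 /=.
  by case: (s1); rewrite /= ?expr0 ?expr1; ring.
have w2 : u2 w = w.
  rewrite /w !rmorphM !rmorphXn u2r1 u2r2 Ds2 /=.
  by case: (s2); rewrite /= ?expr0 ?expr1; ring.
have [a Da] := aut_fixed_rat wK w1 w2.
have E : (2 * (q1 ^ s1 * q2 ^ s2))%N%:R = 1%N%:R * a ^+ 2.
  apply: (fmorph_inj (ratr : {rmorphism rat -> algC})).
  rewrite /= mul1r rmorphXn /= -Da rmorph_nat !natrM !natrX -z2 /w.
  by rewrite !exprMn -!exprM ![(_ * 2)%N]mulnC !exprM !sqrtCK mulrA.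
have sqf1 k : (k ^ 2 %| 1)%N -> k = 1%N.
  by rewrite dvdn1 -mulnn muln_eq1 andbb => /eqP.
have [b Db] := rat_sqr_nat sqf1 E.
have om : odd (q1 ^ s1 * q2 ^ s2) by rewrite oddM !oddX o1 o2 !orbT.
move: Db om; move: (q1 ^ s1 * q2 ^ s2)%N => m; rewrite mul1n => Db om.
have eb : ~~ odd b by have := congr1 odd Db; rewrite oddM oddX /= => <-.
have Dm := odd_double_half m; have Db2 := odd_double_half b.
by move: Db; rewrite -Dm -Db2 om (negPf eb); nia.
Qed.

(** The embedding numbered [i] is realised as the restriction of an automorphism of [algC], so that
    it is a ring morphism by construction. *)
Definition emb (i : 'I_4) : {rmorphism algC -> algC} :=
  (if odd i then u1 else idfun) \o (if odd i./2 then u2 else idfun).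

Lemma emb_r1 i : emb i r1 = (-1) ^+ odd i * r1.
Proof. by rewrite /emb /=; do 2![case: ifP => _]; rewrite /= ?u2r1 ?u1r1; ring. Qed.

Lemma emb_r2 i : emb i r2 = (-1) ^+ odd i./2 * r2.
Proof.
by rewrite /emb /=; do 2![case: ifP => _]; rewrite /= ?u2r2 ?rmorphN ?u1r2 /=; ring.
Qed.

Lemma emb_inK i x : inK x -> inK (emb i x).
Proof.
move=> xK; have x2K : inK ((if odd i./2 then u2 else idfun : {rmorphism algC -> algC}) x).
  by case: ifP => _ //; apply: (inK_aut2 u2r1 u2r2).
by rewrite /emb /=; case: ifP => _ //; apply: (inK_aut1 u1r1 u1r2).
Qed.

(** For every choice of coordinates of [x] the signed sum in [emb_neg] is the image of [x] under
    [emb i], so the existential picks out a single value. *)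
Lemma emb_negE i x : inK x -> emb_neg q1 q2 i x = (emb i x < 0).
Proof.
move=> xK.
have E a b c d : emb i (ratr a + ratr b * r1 + ratr c * r2 + ratr d * (r1 * r2)) =
    ratr a + emb_sign1 i * ratr b * r1 + emb_sign2 i * ratr c * r2
          + emb_sign1 i * emb_sign2 i * ratr d * (r1 * r2).
  rewrite 3!rmorphD (rmorphM _ (ratr b)) (rmorphM _ (ratr c)) (rmorphM _ (ratr d)).
  rewrite !(fmorph_rat (emb i)) (rmorphM _ r1) emb_r1 emb_r2 /emb_sign1 /emb_sign2.
  by do 2![case: (odd _)]; rewrite /= ?expr0 ?expr1; ring.
apply/asboolP/idP => [[a [b [c [d [-> ]]]]]|]; first by rewrite E.
by case: xK => a [b [c [d ->]]]; rewrite E; exists a, b, c, d.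
Qed.

Lemma emb_neq0 i x : x != 0 -> emb i x != 0.
Proof. by rewrite fmorph_eq0. Qed.

Definition F2_of_bool (b : bool) : 'F_2 := if b then 1 else 0.

Lemma F2_of_boolD b c : F2_of_bool (b (+) c) = F2_of_bool b + F2_of_bool c.
Proof. by apply/val_inj; case: b; case: c. Qed.

Lemma signatureM x y : inK x -> inK y -> x != 0 -> y != 0 ->
  signature q1 q2 (x * y) = signature q1 q2 x + signature q1 q2 y.
Proof.
move=> xK yK x0 y0; apply/rowP => i; rewrite !mxE !emb_negE //; last exact: inK_mul.
suff -> : (emb i (x * y) < 0) = (emb i x < 0) (+) (emb i y < 0) by apply: F2_of_boolD.
rewrite rmorphM /=.
have xr := inK_real (emb_inK i xK); have yr := inK_real (emb_inK i yK).
move: (emb_neq0 i x0) (emb_neq0 i y0) => ex0 ey0.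
case: (real_ltgt0P xr) ex0 => // hx _; case: (real_ltgt0P yr) ey0 => // hy _.
- by rewrite pmulr_rlt0 // lt_gtF.
- by rewrite pmulr_rlt0 // hy.
- by rewrite nmulr_rlt0 // hy.
- by rewrite nmulr_rlt0 // lt_gtF.
Qed.

(* The vector of signs of [r1 ^ a * r2 ^ b]. *)
Definition sign_row (a b : bool) : 'rV['F_2]_4 :=
  \row_i F2_of_bool ((a && odd i) (+) (b && odd i./2)).

(** A totally positive product forces its two factors to have equal signs at each embedding, and the
    signs of the radicals are the bits of [i]. *)
Lemma signature_sign_row (a b : bool) z : (0 < q1)%N -> (0 < q2)%N -> inK z ->
  (forall i, 0 < emb i (z * r1 ^+ a * r2 ^+ b)) -> signature q1 q2 z = sign_row a b.
Proof.
move=> p1 p2 zK pos; apply/rowP => i; rewrite !mxE emb_negE //.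
suff -> : (emb i z < 0) = (a && odd i) (+) (b && odd i./2) by [].
have r1p : 0 < r1 by rewrite sqrtC_gt0 ltr0n.
have r2p : 0 < r2 by rewrite sqrtC_gt0 ltr0n.
have := pos i; rewrite 2!rmorphM !rmorphXn emb_r1 emb_r2 !exprMn.
have -> : emb i z * (((-1) ^+ odd i) ^+ a * r1 ^+ a) * (((-1) ^+ odd i./2) ^+ b * r2 ^+ b)
  = emb i z * (-1) ^+ ((a && odd i) (+) (b && odd i./2)) * (r1 ^+ a * r2 ^+ b).
  by rewrite signr_addb; case: (a); case: (b); rewrite /= ?expr0 ?expr1; ring.
rewrite pmulr_lgt0; last by rewrite mulr_gt0 ?exprn_gt0.
case: (_ (+) _); rewrite ?expr1 ?expr0 ?mulr1 ?mulrN1 ?oppr_gt0 // => h.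
by rewrite lt_gtF.
Qed.

End Emb.

(** * Linear algebra over F_2 on sign vectors *)

Lemma free_sign_rows (a b c d : bool) : (a && d) (+) (b && c) ->
  free [:: const_mx 1%R; sign_row a b; sign_row c d : 'rV['F_2]_4].
Proof.
move=> det; apply/(@freeP _ _ 3 [tuple _; _; _]) => k.
rewrite !big_ord_recl big_ord0 /= => /rowP k0.
(* At the identity embedding both sign rows vanish, which kills the coefficient of the all-ones row.
   Columns 1 and 2 then give a 2 by 2 system whose determinant is the hypothesis. *)
have e0 := k0 (inord 0); have e1 := k0 (inord 1); have e2 := k0 (inord 2).
move: e0 e1 e2; rewrite !mxE !inordK //=.
rewrite !andbT !andbF !addbF /= !mulr1 !addr0 !mulr0 !addr0 => k00 k01 k02.
have [z1 z2] : k (lift ord0 ord0) = 0 /\ k (lift ord0 (lift ord0 ord0)) = 0.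
  move: k01 k02 det; rewrite k00 !add0r; move: (k _) (k _) => x y.
  case: (a); case: (b); case: (c); case: (d); rewrite /= ?mulr1 ?mulr0 ?addr0 ?add0r //.
  - by move=> + x0; rewrite x0 add0r.
  - by move=> x0; rewrite x0 add0r.
  - by move=> + y0; rewrite y0 addr0.
  - by move=> y0; rewrite y0 addr0.
case=> [[|[|[|//]]]] h.
- by rewrite -k00; congr k; apply: val_inj.
- by rewrite -z1; congr k; apply: val_inj.
- by rewrite -z2; congr k; apply: val_inj.
Qed.

(** The boolean added to 2 is the determinant of the two sign rows. When it vanishes, the row of (a,
    b) is zero or equals the row of (j, ~~ j), and the all-ones row and the latter remain
    independent. *)
Lemma dim_sign_rows (a b j : bool) :
  \dim <<[:: const_mx 1%R : 'rV['F_2]_4; sign_row a b; sign_row j (~~ j)]>>%VS =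
    (2 + ((a && ~~ j) (+) (b && j)))%N.
Proof.
have [det|det] := boolP ((a && ~~ j) (+) (b && j)).
  by have /eqP -> := free_sign_rows det.
have free2 : free [:: const_mx 1%R : 'rV['F_2]_4; sign_row j (~~ j)].
  have det2 : (j && j) (+) (~~ j && ~~ j) by case: (j).
  have := @free_sign_rows j (~~ j) (~~ j) j det2.
  by rewrite -[[:: _; _; _]]/([:: _; _] ++ [:: _]); apply: catl_free.
have -> : <<[:: const_mx 1%R; sign_row a b; sign_row j (~~ j)]>>%VS =
    <<[:: const_mx 1%R : 'rV['F_2]_4; sign_row j (~~ j)]>>%VS.
  apply/eqP; rewrite eqEsubv; apply/andP; split; apply/span_subvP => v; last first.
    by move=> h; apply: memv_span; move: h; rewrite !inE => /orP[] -> //; rewrite !orbT.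
  have T0 : sign_row false false = 0 by apply/rowP => i; rewrite !mxE.
  rewrite !inE => /or3P[] /eqP ->; try by apply: memv_span; rewrite !inE eqxx ?orbT.
  case: j a b det {free2} => [] [] [] // _; rewrite ?T0 ?mem0v //.
    by apply: memv_span; rewrite !inE eqxx orbT.
  by apply: memv_span; rewrite !inE eqxx orbT.
by have /eqP -> := free2.
Qed.

(** * Square classes of the three fundamental units *)

Lemma int_parity (m : int) : exists (k : int) (s : bool), m = k * 2%:Z + s%:Z.
Proof. by exists (m %/ 2)%Z, ((m %% 2)%Z == 1); lia. Qed.

Lemma sqr_add1 (e A : algC) : e != 0 -> e + e^-1 = A -> (1 + e) ^+ 2 = e * (A + 2%:R).
Proof. by move=> e0 <-; field. Qed.

(** The boolean exponent merges the two classes 2 and 2q of [trace_prime] into one formula; it later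
    becomes an argument of [sign_row]. *)
Lemma fund_unit_prime (q : nat) (u : {rmorphism algC -> algC}) (e : algC) :
  prime q -> (q %% 4 = 3)%N -> u (sqrtC q%:R) = - sqrtC q%:R ->
  is_fund_unit_quad q e ->
  u e = e^-1 /\ exists w, (0 < w)%N /\
    (1 + e) ^+ 2 = e * (2%:R * w%:R ^+ 2 * q%:R ^+ (q %% 8 == 3)%N).
Proof.
move=> pq q4 uq fe; have sqf k : (k ^ 2 %| q)%N -> k = 1%N by apply: prime_sqf.
have [A [B [ue TA DA A2 nsq]]] := fund_unit_trace pq q4 (dvdnn q) sqf uq fe.
have e0 : e != 0 by case: fe => -[_ []].
split=> //; rewrite (sqr_add1 e0 TA) -natrD.
have [w [w0 [[q8 ->]|[q8 ->]]]] := trace_prime pq q4 DA A2 nsq; exists w; split=> //.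
  by rewrite q8 mulr1 (natrM _ 2) -natrX.
by rewrite q8 (natrM _ 2) (natrM _ q) -natrX; ring.
Qed.

(** The boolean [j] records which prime represents the class of [e]. Either trace equation
    determines the Legendre symbol, hence the two implications. *)
Lemma fund_unit_prod (q1 q2 : nat) (u : {rmorphism algC -> algC}) (e : algC) :
  prime q1 -> prime q2 -> q1 != q2 -> (q1 %% 4 = 3)%N -> (q2 %% 4 = 3)%N ->
  u (sqrtC (q1 * q2)%:R) = - sqrtC (q1 * q2)%:R ->
  is_fund_unit_quad (q1 * q2) e ->
  u e = e^-1 /\ exists w (j : bool), [/\ (0 < w)%N,
    (1 + e) ^+ 2 = e * (w%:R ^+ 2 * (q1%:R ^+ j * q2%:R ^+ ~~ j)),
    legendre q1 q2 = 1 -> j & legendre q1 q2 = -1 -> ~~ j].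
Proof.
move=> p1 p2 npq q14 q24 uq fe.
have sqf k : (k ^ 2 %| q1 * q2)%N -> k = 1%N by apply: prime_mul_sqf.
have [A [B [ue TA DA A2 nsq]]] := fund_unit_trace p1 q14 (dvdn_mulr q2 (dvdnn q1)) sqf uq fe.
have e0 : e != 0 by case: fe => -[_ []].
split=> //; rewrite (sqr_add1 e0 TA) -natrD.
have [w [z [[E1 E2]|[E1 E2]]]] := trace_prod p1 p2 q14 q24 DA A2 nsq.
  exists w, true; split=> //.
  - by case: (w) E1 => //; lia.
  - by rewrite E1 natrM natrX; ring.
  - by rewrite (@legendre_eq1 q1 q2 w z p1 p2 npq q24) //; lia.
exists w, false; split=> //.
- by case: (w) E1 => //; lia.
- by rewrite E1 natrM natrX; ring.
- by rewrite (@legendre_eqN1 q1 q2 w z p1 p2 npq q24) //; lia.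
Qed.

(** * Units of K and their relations *)

Section Main.
Variables (q1 q2 : nat) (u1 u2 : {rmorphism algC -> algC}) (e1 e2 e3 : algC).
Local Notation r1 := (sqrtC q1%:R : algC).
Local Notation r2 := (sqrtC q2%:R : algC).
Local Notation inK := (inK q1 q2).
Hypotheses (p1 : prime q1) (p2 : prime q2) (npq : q1 != q2).
Hypotheses (q14 : (q1 %% 4 = 3)%N) (q24 : (q2 %% 4 = 3)%N).
Hypotheses (u1r1 : u1 r1 = - r1) (u1r2 : u1 r2 = r2).
Hypotheses (u2r1 : u2 r1 = r1) (u2r2 : u2 r2 = - r2).
Hypotheses (f1 : is_fund_unit_quad q1 e1) (f2 : is_fund_unit_quad q2 e2).
Hypothesis f3 : is_fund_unit_quad (q1 * q2) e3.

Let e1_gt0 : 0 < e1. Proof. by case: f1 => _ [h _]; apply: lt_trans h; rewrite ltr01. Qed.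
Let e2_gt0 : 0 < e2. Proof. by case: f2 => _ [h _]; apply: lt_trans h; rewrite ltr01. Qed.
Let e3_gt0 : 0 < e3. Proof. by case: f3 => _ [h _]; apply: lt_trans h; rewrite ltr01. Qed.
Let e1_neq0 : e1 != 0. Proof. by rewrite gt_eqF. Qed.
Let e2_neq0 : e2 != 0. Proof. by rewrite gt_eqF. Qed.
Let e3_neq0 : e3 != 0. Proof. by rewrite gt_eqF. Qed.
Let e1K : inK e1. Proof. by case: f1 => -[h _] _; apply: inQsqrt1_inK. Qed.
Let e2K : inK e2. Proof. by case: f2 => -[h _] _; apply: inQsqrt2_inK. Qed.
Let e3K : inK e3. Proof. by case: f3 => -[h _] _; apply: inQsqrt12_inK. Qed.

Let u1e1 : u1 e1 = e1^-1.
Proof. by case: (fund_unit_prime p1 q14 u1r1 f1). Qed.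
Let u2e2 : u2 e2 = e2^-1.
Proof. by case: (fund_unit_prime p2 q24 u2r2 f2). Qed.
Let u1e3 : u1 e3 = e3^-1.
Proof.
case: (@fund_unit_prod _ _ u1 _ p1 p2 npq q14 q24 _ f3) => //.
by rewrite sqrtC_mul12 rmorphM u1r1 u1r2 mulNr.
Qed.
Let u2e3 : u2 e3 = e3^-1.
Proof.
case: (@fund_unit_prod _ _ u2 _ p1 p2 npq q14 q24 _ f3) => //.
by rewrite sqrtC_mul12 rmorphM u2r1 u2r2 mulrN.
Qed.
Let u2e1 : u2 e1 = e1.
Proof.
case: f1 => -[[a [b ->]] _] _.
by rewrite rmorphD (rmorphM u2 (ratr b)) !(fmorph_rat u2) u2r1.
Qed.
Let u1e2 : u1 e2 = e2.
Proof.
case: f2 => -[[a [b ->]] _] _.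
by rewrite rmorphD (rmorphM u1 (ratr b)) !(fmorph_rat u1) u1r2.
Qed.

Let expz_eq1 (e : algC) (k : int) : 1 < e -> e ^ k = 1 -> k = 0.
Proof.
move=> e_gt1 /eqP; rewrite pexprz_eq1 ?(ltW (lt_trans ltr01 e_gt1)) //.
by rewrite (gt_eqF e_gt1) orbF => /eqP.
Qed.

(** Each of [u1] and [u2] inverts two of the three powers and fixes the third. Multiplying the
    relation by its conjugates isolates the square of each power, and the bases exceed 1. *)
Lemma fund_units_independent (a b c : int) :
  e1 ^ a * e2 ^ b * e3 ^ c = 1 -> [/\ a = 0, b = 0 & c = 0].
Proof.
move=> h; have h1 := congr1 u1 h; have h2 := congr1 u2 h.
move: h1 h2; rewrite !rmorphM !rmorph1 !fmorphXz u1e1 u1e2 u1e3 u2e1 u2e2 u2e3 !exprz_inv -!invr_expz.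
have sq (e : algC) k : 1 < e -> (e ^ k) ^+ 2 = 1 -> k = 0.
  move=> e_gt1; rewrite exprnP exprz_exp => /(expz_eq1 e_gt1)/eqP.
    by rewrite mulf_eq0 orbF => /eqP.
have [g1 g2 g3] : [/\ 1 < e1, 1 < e2 & 1 < e3].
  by split; [case: f1 => _ [] | case: f2 => _ [] | case: f3 => _ []].
have : [/\ e1 ^ a != 0, e2 ^ b != 0 & e3 ^ c != 0] by rewrite !expfz_neq0.
move: (sq _ a g1) (sq _ b g2) (sq _ c g3) h.
move: (e1 ^ a) (e2 ^ b) (e3 ^ c) => P Q R hP hQ hR h [P0 Q0 R0] h1 h2.
have P2 : P ^+ 2 = 1.
  have : (P * Q * R) * (P * Q^-1 * R^-1) = P ^+ 2 by field; rewrite Q0 R0.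
  by rewrite h h2 mulr1 => <-.
have Q2 : Q ^+ 2 = 1.
  have : (P * Q * R) * (P^-1 * Q * R^-1) = Q ^+ 2 by field; rewrite P0 R0.
  by rewrite h h1 mulr1 => <-.
have R2 : R ^+ 2 = 1.
  have : (P * Q * R) ^+ 2 = P ^+ 2 * Q ^+ 2 * R ^+ 2 by ring.
  by rewrite h P2 Q2 expr1n !mul1r => <-.
by split; [apply: hP | apply: hQ | apply: hR].
Qed.

(* [u ^ 2 * u1 (N3 u) = N1 u * N2 u] for the three relative norms [N1, N2, N3]
   onto the quadratic subfields. *)
Lemma unit_sqr (u : algC) : is_unit_of inK u ->
  exists a b c : int, u ^+ 2 = e1 ^ a * e2 ^ b * e3 ^ c.
Proof.
case=> uK [u0 [Au Av]].
have ue_unit (v : {rmorphism algC -> algC}) : v u != 0 /\ (v u \in Aint /\ (v u)^-1 \in Aint).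
  by rewrite fmorph_eq0 -fmorphV !Aint_aut.
have norm_unit (F : algC -> Prop) (v : {rmorphism algC -> algC}) : F (u * v u) -> is_unit_of F (u * v u).
  case: (ue_unit v) => v0 [Av1 Av2] Fx; split=> //; split; first exact: mulf_neq0.
  by rewrite invfM !rpredM.
have u1K := inK_aut1 u1r1 u1r2 uK; have u2K := inK_aut2 u2r1 u2r2 uK.
have n1 : is_unit_of (inQsqrt q1) (u * u2 u).
  apply: norm_unit; apply: (aut2_fixed u2r1 u2r2); first exact: inK_mul.
  by rewrite rmorphM (aut2K u2r1 u2r2) // mulrC.
have n2 : is_unit_of (inQsqrt q2) (u * u1 u).
  apply: norm_unit; apply: (aut1_fixed u1r1 u1r2); first exact: inK_mul.
  by rewrite rmorphM (aut1K u1r1 u1r2) // mulrC.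
have n3 : is_unit_of (inQsqrt (q1 * q2)) (u * (u1 \o u2) u).
  apply: (norm_unit _ (u1 \o u2)); apply: (aut12_fixed u1r1 u1r2 u2r1 u2r2) => /=.
    by apply: inK_mul => //; apply: (inK_aut1 u1r1 u1r2).
  rewrite !rmorphM (aut12C u1r1 u1r2 u2r1 u2r2 u2K) (aut2K u2r1 u2r2) //.
  by rewrite (aut1K u1r1 u1r2) // mulrC.
have E : u ^+ 2 * u1 (u * u1 (u2 u)) = (u * u2 u) * (u * u1 u).
  by rewrite rmorphM (aut1K u1r1 u1r2) //; ring.
case: f1 => _ [_ /(_ _ n1)[a Da]]; case: f2 => _ [_ /(_ _ n2)[b Db]].
case: f3 => _ [_ /(_ _ n3)[c Dc]]; exists a, b, c.
have [a0 b0 c0] : [/\ 0 < e1 ^ a, 0 < e2 ^ b & 0 < e3 ^ c] by rewrite !exprz_gt0.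
have u2_gt0 : 0 < u ^+ 2.
  by rewrite real_exprn_even_gt0 ?(inK_real uK).
(* Absolute values remove the unknown signs of the three relative norms; u^2 is positive because [u]
   is real. The factor [u1] (N3 u) contributes the inverse of e3^c. *)
move: E u2_gt0; move: (u ^+ 2) => U /(congr1 Num.norm) + U_gt0.
rewrite normrM (gtr0_norm U_gt0).
have -> : `|u1 (u * u1 (u2 u))| = (e3 ^ c)^-1.
  by case: Dc => /= ->; rewrite ?rmorphN fmorphXz u1e3 exprz_inv -invr_expz ?normrN gtr0_norm ?invr_gt0.
have -> : `|(u * u2 u) * (u * u1 u)| = e1 ^ a * e2 ^ b.
  by rewrite normrM; case: Da => ->; case: Db => ->; rewrite ?normrN !gtr0_norm.
by move=> <-; rewrite mulfVK ?gt_eqF.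
Qed.

(** Each conjugate of one of the three units is that unit or its inverse, so the units are totally
    positive. *)
Let emb_e1_gt0 i : 0 < emb u1 u2 i e1.
Proof.
by rewrite /emb /=; do 2![case: ifP => _]; rewrite /= ?u2e1 ?u1e1 ?invr_gt0.
Qed.
Let emb_e2_gt0 i : 0 < emb u1 u2 i e2.
Proof.
by rewrite /emb /=; do 2![case: ifP => _]; rewrite /= ?u2e2 ?fmorphV ?u1e2 ?invr_gt0.
Qed.
Let emb_e3_gt0 i : 0 < emb u1 u2 i e3.
Proof.
by rewrite /emb /=; do 2![case: ifP => _]; rewrite /= ?u2e3 ?fmorphV ?u1e3 ?invr_gt0 ?invrK.
Qed.

(** * Square roots of units inside K *)

Let r1_neq0 (b : bool) : r1 ^+ b != 0.
Proof. by rewrite expf_neq0 // sqrtC_eq0 pnatr_eq0 -lt0n prime_gt0. Qed.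
Let r2_neq0 (b : bool) : r2 ^+ b != 0.
Proof. by rewrite expf_neq0 // sqrtC_eq0 pnatr_eq0 -lt0n prime_gt0. Qed.
Let r1_sqr (b : bool) : (r1 ^+ b) ^+ 2 = q1%:R ^+ b.
Proof. by rewrite exprAC sqrtCK. Qed.
Let r2_sqr (b : bool) : (r2 ^+ b) ^+ 2 = q2%:R ^+ b.
Proof. by rewrite exprAC sqrtCK. Qed.
Let q1_neq0 (b : bool) : q1%:R ^+ b != 0 :> algC.
Proof. by rewrite -r1_sqr expf_neq0. Qed.
Let q2_neq0 (b : bool) : q2%:R ^+ b != 0 :> algC.
Proof. by rewrite -r2_sqr expf_neq0. Qed.
Let add1K x : inK x -> inK (1 + x).
Proof. by apply: inK_add; apply: (inK_nat q1 q2 1). Qed.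
Let r1K (b : bool) : inK (r1 ^+ b).
Proof. exact/(inK_exprz u1r1 u1r2 u2r1 u2r2 b)/inK_r1. Qed.
Let r2K (b : bool) : inK (r2 ^+ b).
Proof. exact/(inK_exprz u1r1 u1r2 u2r1 u2r2 b)/inK_r2. Qed.
Let divK x y : inK x -> inK y -> inK (x / y).
Proof. by move=> xK yK; apply: inK_mul => //; apply: (inK_inv u1r1 u1r2 u2r1 u2r2). Qed.

Lemma sqrt_fund_units12 : exists x, [/\ inK x, x ^+ 2 = e1 * e2 &
  signature q1 q2 x = sign_row (q1 %% 8 == 3)%N (q2 %% 8 == 3)%N].
Proof.
have [_ [w1 [w1_gt0 E1]]] := fund_unit_prime p1 q14 u1r1 f1.
have [_ [w2 [w2_gt0 E2]]] := fund_unit_prime p2 q24 u2r2 f2.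
move: E1 E2; move: (q1 %% 8 == 3)%N (q2 %% 8 == 3)%N => a b E1 E2.
(* Multiplying the formulas for (1 + e1)^2 and (1 + e2)^2, the two factors 2 combine with w1^2 w2^2
   into n^2, leaving only [q1 ^ a] and [q2 ^ b]. *)
pose n := (2 * w1 * w2)%N.
have n_gt0 : 0 < n%:R :> algC by rewrite ltr0n !muln_gt0 w1_gt0.
have n_neq0 : n%:R != 0 :> algC by rewrite gt_eqF.
pose x := (1 + e1) * (1 + e2) / n%:R / (r1 ^+ a * r2 ^+ b).
have xK : inK x.
  apply: divK; last exact: inK_mul.
  by apply: divK; [apply: inK_mul; apply: add1K | apply: inK_nat].
exists x; split=> //.
  have nE : (n%:R : algC) ^+ 2 = 4%:R * w1%:R ^+ 2 * w2%:R ^+ 2 by rewrite /n !natrM; ring.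
  rewrite !expr_div_n !exprMn E1 E2 nE r1_sqr r2_sqr.
  move: (q1_neq0 a) (q2_neq0 b); move: (_ ^+ a) (_ ^+ b) => s1 s2 s1_neq0 s2_neq0.
  have [w1_neq0 w2_neq0] : w1%:R != 0 :> algC /\ w2%:R != 0 :> algC.
    by rewrite !pnatr_eq0 -!lt0n.
  by field; rewrite s1_neq0 s2_neq0 w1_neq0 w2_neq0.
apply: (signature_sign_row u1r1 u1r2 u2r1 u2r2); rewrite ?prime_gt0 // => i.
(* Clearing the radicals leaves a quotient of sums and products of totally positive numbers. *)
have -> : x * r1 ^+ a * r2 ^+ b = (1 + e1) * (1 + e2) / n%:R.
  by rewrite -mulrA mulfVK // mulf_neq0.
rewrite rmorphM fmorphV rmorphM !rmorphD rmorph1 rmorph_nat.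
by rewrite divr_gt0 // mulr_gt0 // addr_gt0 ?ltr01.
Qed.

Lemma sqrt_fund_unit3 : exists y (j : bool), [/\ inK y, y ^+ 2 = e3,
  signature q1 q2 y = sign_row j (~~ j), legendre q1 q2 = 1 -> j &
  legendre q1 q2 = -1 -> ~~ j].
Proof.
have uD : u1 (sqrtC (q1 * q2)%:R) = - sqrtC (q1 * q2)%:R.
  by rewrite sqrtC_mul12 rmorphM u1r1 u1r2 mulNr.
have [_ [w [j [w_gt0 E3 leg1 legN1]]]] := fund_unit_prod p1 p2 npq q14 q24 uD f3.
have wr_gt0 : 0 < w%:R :> algC by rewrite ltr0n.
have wr_neq0 : w%:R != 0 :> algC by rewrite gt_eqF.
pose y := (1 + e3) / w%:R / (r1 ^+ j * r2 ^+ ~~ j).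
have yK : inK y.
  apply: divK; last exact: inK_mul.
  by apply: divK; [apply: add1K | apply: inK_nat].
exists y, j; split=> //.
  rewrite !expr_div_n !exprMn E3 r1_sqr r2_sqr.
  move: (q1_neq0 j) (q2_neq0 (~~ j)); move: (_ ^+ j) (_ ^+ ~~ j) => s1 s2 s1_neq0 s2_neq0.
  by field; rewrite s1_neq0 s2_neq0.
apply: (signature_sign_row u1r1 u1r2 u2r1 u2r2); rewrite ?prime_gt0 // => i.
have -> : y * r1 ^+ j * r2 ^+ (~~ j) = (1 + e3) / w%:R.
  by rewrite -mulrA mulfVK // mulf_neq0.
rewrite rmorphM fmorphV rmorphD rmorph1 rmorph_nat.
by rewrite divr_gt0 // addr_gt0 ?ltr01.
Qed.

Lemma inK_sqrt x y : inK y -> x ^+ 2 = y ^+ 2 -> inK x.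
Proof.
by move=> yK /eqP; rewrite eqf_sqr => /orP[] /eqP -> //; apply: inK_opp.
Qed.

Lemma sqrt_unit x : inK x -> x ^+ 2 != 0 -> x ^+ 2 \in Aint -> (x ^+ 2)^-1 \in Aint ->
  is_unit_of inK x.
Proof.
move=> xK x0 Ax Ax'; split=> //; split; first by move: x0; rewrite expf_eq0.
by split; apply: Aint_sqrt; rewrite ?exprVn.
Qed.

(** The square class of [e2] is 2 or 2 q2, and [q2] is a square in K; a root [v] would therefore
    produce a square root of 2 in K. *)
Lemma sqrt_e2_notin v : inK v -> v ^+ 2 <> e2.
Proof.
move=> vK v2; have [_ [w [w_gt0 E2]]] := fund_unit_prime p2 q24 u2r2 f2.
move: E2; move: (_ == _) => b E2.
have w0 : w%:R != 0 :> algC by rewrite pnatr_eq0 -lt0n.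
have v0 : v != 0 by apply: contraNneq e2_neq0 => v0; rewrite -v2 v0 expr0n.
apply: (@sqrt2_notin_K q1 q2 _ _ u1r1 u1r2 u2r1 u2r2 ((1 + e2) / (v * w%:R * r2 ^+ b))).
- exact: odd_mod4 q14.
- exact: odd_mod4 q24.
- by apply: divK; [apply: add1K | apply: inK_mul => //; apply: inK_mul => //; apply: inK_nat].
rewrite expr_div_n !exprMn E2 v2 r2_sqr.
move: (q2_neq0 b); move: (_ ^+ b) => s s_neq0.
by field; rewrite s_neq0 w0.
Qed.

Lemma fund_system_sqrt x y : x ^+ 2 = e1 * e2 -> y ^+ 2 = e3 -> inK x -> inK y ->
  fund_system3 inK x y e2.
Proof.
move=> x2 y2 xK yK.
have expzK k z : inK z -> inK (z ^ k) by apply: (inK_exprz u1r1 u1r2 u2r1 u2r2).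
case: (f1) (f2) (f3) => -[_ [_ [A1 A1']]] _ [[_ [_ [A2 A2']]] _] [[_ [_ [A3 A3']]] _].
have xU : is_unit_of inK x.
  by apply: sqrt_unit; rewrite ?x2 ?mulf_neq0 ?invfM ?rpredM.
have yU : is_unit_of inK y by apply: sqrt_unit; rewrite ?y2.
have x0 : x != 0 by case: xU => _ [].
have y0 : y != 0 by case: yU => _ [].
have sqz (z : algC) (k : int) : (z ^ k) ^+ 2 = (z ^+ 2) ^ k by rewrite !exprnP exprzAC.
split=> // [u uU|a b c h].
  have [a [b [c Du2]]] := unit_sqr uU.
  (* Matching the exponents of [e1] and [e3] forces x^a y^c; what remains of u^2 is e2^(b - a), of
     which [g] absorbs the even part. *)
  have [k [s Dk]] := int_parity (b - a); pose g := x ^ a * y ^ c * e2 ^ k.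
  have g0 : g != 0 by rewrite !mulf_neq0 ?expfz_neq0.
  have gK : inK g by apply: inK_mul; [apply: inK_mul|]; apply: expzK.
  have Eg : u ^+ 2 = g ^+ 2 * e2 ^+ s.
    rewrite /g !exprMn (sqz x) (sqz y) x2 y2 [(e2 ^ k) ^+ 2]exprnP exprz_exp [e2 ^+ s]exprnP.
    have Db : b = a + k * 2%:Z + s%:Z by rewrite -addrA -Dk addrC subrK.
    rewrite Du2 Db !expfzDr // exprzMl ?unitfE //; ring.
  (* An odd remainder would exhibit [e2] as the square of u / g; otherwise u^2 = g^2. *)
  exists a, c, k; rewrite -/g; case: s Eg {Dk} => Eg.
    case: (@sqrt_e2_notin (u / g)); first by apply: divK => //; case: uU.
    by rewrite expr_div_n Eg mulrAC mulfV ?mul1r // expf_neq0.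
  move: Eg; rewrite mulr1 => /eqP; rewrite eqf_sqr.
  by case/orP=> /eqP; [left | right].
(* Squaring the relation turns it into one between the three quadratic units, where independence is
   known. *)
have : e1 ^ a * e2 ^ (a + c * 2) * e3 ^ b = 1.
  have : (x ^ a * y ^ b * e2 ^ c) ^+ 2 = 1 by case: h => ->; rewrite ?sqrrN expr1n.
  rewrite !exprMn (sqz x) (sqz y) x2 y2 exprzMl ?unitfE // [(e2 ^ c) ^+ 2]exprnP exprz_exp => <-.
  by rewrite expfzDr //; ring.
case/fund_units_independent=> -> + ->; rewrite add0r => /eqP.
by rewrite mulf_eq0 orbF => /eqP.
Qed.

(** The signature turns products into sums, so the span comes from the generators -1, [x], [y] and
    [e2]. The first has the all-ones signature, and the totally positive [e2] contributes zero. *)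
Lemma unit_signature_rankE x y (a b c d : bool) : fund_system3 inK x y e2 ->
  signature q1 q2 x = sign_row a b -> signature q1 q2 y = sign_row c d ->
  unit_signature_rank q1 q2 =
    \dim <<[:: const_mx 1%R : 'rV['F_2]_4; sign_row a b; sign_row c d]>>%VS.
Proof.
case=> xU yU zU gen _ Sx Sy; rewrite /unit_signature_rank; congr (\dim _).
set V := <<[:: _; _; _]>>%VS.
have SM := signatureM u1r1 u1r2 u2r1 u2r2.
have pos_sig z : inK z -> (forall i, 0 < emb u1 u2 i z) -> signature q1 q2 z = 0.
  move=> zK pos; rewrite (@signature_sign_row _ _ _ _ u1r1 u1r2 u2r1 u2r2 false false) ?prime_gt0 //.
    by apply/rowP => i; rewrite !mxE.
  by move=> i; rewrite !mulr1.
have oneK := inK_nat q1 q2 1.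
have S1 : signature q1 q2 1 = 0 by apply: pos_sig => // i; rewrite rmorph1 ltr01.
have SN1 : signature q1 q2 (- 1) = const_mx 1.
  apply/rowP => i; rewrite !mxE (emb_negE u1r1 u1r2 u2r1 u2r2); last exact: inK_opp.
  by rewrite rmorphN1 oppr_lt0 ltr01.
have VX z k : inK z -> z != 0 -> signature q1 q2 z \in V -> signature q1 q2 (z ^ k) \in V.
  move=> zK z0 zV.
  have nat_pow n : signature q1 q2 (z ^+ n) \in V.
    elim: n => [|n IH]; first by rewrite S1 mem0v.
    rewrite exprS SM ?rpredD ?expf_neq0 //.
    exact: (inK_exprz u1r1 u1r2 u2r1 u2r2 n).
  case: k => n; first exact: nat_pow.
  have zn0 : z ^+ n.+1 != 0 by rewrite expf_neq0.
  have znK : inK (z ^+ n.+1) := inK_exprz u1r1 u1r2 u2r1 u2r2 n.+1 zK.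
  (* For negative exponents the signature of the inverse is read off from that of the product 1,
     which is zero. *)
  have := S1; rewrite -(mulfV zn0) SM ?invr_neq0 //; last exact: (inK_inv u1r1 u1r2 u2r1 u2r2).
  by rewrite addrC => /eqP; rewrite addr_eq0 => /eqP ->; rewrite rpredN.
have inV v : v \in [:: const_mx 1%R : 'rV['F_2]_4; sign_row a b; sign_row c d] -> v \in V.
  exact: memv_span.
have unitV u : is_unit_of inK u -> signature q1 q2 u \in V.
  move=> uU; case: xU yU zU => xK [x0 _] [yK [y0 _]] [zK [z0 _]].
  have [i [j [k Du]]] := gen u uU.
  have xi : signature q1 q2 (x ^ i) \in V.
    by apply: VX; rewrite // Sx inV // !inE eqxx orbT.
  have yj : signature q1 q2 (y ^ j) \in V.
    by apply: VX; rewrite // Sy inV // !inE eqxx !orbT.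
  have zk : signature q1 q2 (e2 ^ k) \in V by apply: VX; rewrite // pos_sig ?mem0v.
  have expzK t z : inK z -> inK (z ^ t) by apply: (inK_exprz u1r1 u1r2 u2r1 u2r2).
  have gK : inK (x ^ i * y ^ j * e2 ^ k) by apply: inK_mul; [apply: inK_mul|]; apply: expzK.
  have g0 : x ^ i * y ^ j * e2 ^ k != 0 by rewrite !mulf_neq0 ?expfz_neq0.
  have gV : signature q1 q2 (x ^ i * y ^ j * e2 ^ k) \in V.
    rewrite SM ?mulf_neq0 ?expfz_neq0 //; [|by apply: inK_mul; apply: expzK|exact: expzK].
    by rewrite SM ?expfz_neq0 ?rpredD //; apply: expzK.
  case: Du => ->; rewrite // -mulN1r SM ?oppr_eq0 ?oner_eq0 //; last exact: inK_opp.
  by rewrite SN1 rpredD // inV // inE eqxx.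
apply/eqP; rewrite eqEsubv; apply/andP; split; apply/span_subvP => v.
  by rewrite mem_enum inE => /asboolP[u [uU <-]]; apply: unitV.
have memS u : is_unit_of inK u -> signature q1 q2 u \in <<enum (unit_signatures q1 q2)>>%VS.
  by move=> uU; apply: memv_span; rewrite mem_enum inE; apply/asboolP; exists u.
rewrite !inE => /or3P[] /eqP ->; rewrite -?Sx -?Sy; [|exact: memS..].
rewrite -SN1; apply: memS; split; first exact: inK_opp.
by rewrite oppr_eq0 oner_eq0 invrN1 rpredN Aint1.
Qed.

End Main.

(** * Conjugations of K, and the rank in each residue case *)

Lemma biquadratic_auts (q1 q2 : nat) : prime q1 -> prime q2 -> q1 != q2 ->
  exists u1 u2 : {rmorphism algC -> algC},
    [/\ u1 (sqrtC q1%:R) = - sqrtC q1%:R, u1 (sqrtC q2%:R) = sqrtC q2%:R,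
        u2 (sqrtC q1%:R) = sqrtC q1%:R & u2 (sqrtC q2%:R) = - sqrtC q2%:R].
Proof.
move=> p1 p2 npq; have npq' : q2 != q1 by rewrite eq_sym.
have [u1 [u11 u12]] := sqrt_aut (sqrt_notin_Qsqrt p1 p2 npq).
have [u2 [u22 u21]] := sqrt_aut (sqrt_notin_Qsqrt p2 p1 npq').
by exists u1, u2.
Qed.

Unset Implicit Arguments.

Theorem theorem5p2 (q1 q2 : nat) (e1 e2 e3 : algC) :
  prime q1 -> prime q2 -> q1 != q2 ->
  (q1 %% 4 = 3)%N -> (q2 %% 4 = 3)%N ->
  is_fund_unit_quad q1 e1 -> is_fund_unit_quad q2 e2 ->
  is_fund_unit_quad (q1 * q2) e3 ->
  [/\ (forall x, x ^+ 2 = e1 * e2 -> inK q1 q2 x),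
      (forall y, y ^+ 2 = e3 -> inK q1 q2 y)
    & (forall x y, x ^+ 2 = e1 * e2 -> y ^+ 2 = e3 ->
         fund_system3 (inK q1 q2) x y e2)] /\
  [/\ ((q1 %% 8 = 3)%N -> (q2 %% 8 = 3)%N ->
         (unit_signature_rank q1 q2 = 3 /\ deficiency q1 q2 = 1)%N),
      ((q1 %% 8 = 7)%N -> (q2 %% 8 = 7)%N ->
         (unit_signature_rank q1 q2 = 2 /\ deficiency q1 q2 = 2)%N)
    & ((q1 %% 8 = 7)%N -> (q2 %% 8 = 3)%N ->
         (legendre q1 q2 = 1 ->
            (unit_signature_rank q1 q2 = 3 /\ deficiency q1 q2 = 1)%N) /\
         (legendre q1 q2 = -1 ->
            (unit_signature_rank q1 q2 = 2 /\ deficiency q1 q2 = 2)%N))].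
Proof.
move=> p1 p2 npq q14 q24 f1 f2 f3.
have [u1 [u2 [u11 u12 u21 u22]]] := biquadratic_auts p1 p2 npq.
have [x [xK x2 Sx]] := sqrt_fund_units12 p1 p2 q14 q24 u11 u12 u21 u22 f1 f2.
have [y [j [yK y2 Sy leg1 legN1]]] :=
  sqrt_fund_unit3 p1 p2 npq q14 q24 u11 u12 u21 u22 f3.
have sysP := fund_system_sqrt p1 p2 npq q14 q24 u11 u12 u21 u22 f1 f2 f3.
(* Any square root differs from the constructed one at most by sign. *)
have inKx z : z ^+ 2 = e1 * e2 -> inK q1 q2 z.
  by move=> z2; apply: (inK_sqrt xK); rewrite x2.
have inKy z : z ^+ 2 = e3 -> inK q1 q2 z.
  by move=> z2; apply: (inK_sqrt yK); rewrite y2.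
have rk := unit_signature_rankE p1 p2 q24 u11 u12 u21 u22 f2 (sysP _ _ x2 y2 xK yK) Sx Sy.
rewrite dim_sign_rows in rk.
split; [split=> // z t z2 t2; apply: sysP; by [|apply: inKx|apply: inKy]|].
(* The rank is 2 plus a determinant: that determinant is 1 for either [j] when both primes are 3
   modulo 8, is 0 when both are 7, and equals [j] in the mixed case, where the Legendre symbol fixes
   [j]. *)
rewrite /deficiency rk; split=> [-> ->|-> ->|-> ->].
- by case: (j).
- by [].
- by split=> [/leg1 ->|/legN1 /negPf ->].
Qed.
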